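(* Let $B\in\mathcal{B}$ and let $x^\circ$ be a feasible solution for $\mathcal{G}^B$. Then $\mathit{IFR}(\mathcal{S}^B,x^\circ_N)=\mathit{IFR}(\mathcal{G}^B,x^\circ)$.
   Context: Let $m\le n$, let $A\in\mathbb{Z}^{m\times n}$ have full row rank, and let $b\in\mathbb{Z}^m$, $c\in\mathbb{R}^n$. The integer program $\mathcal{IP}$ is $\min\{c^\intercal x\mid Ax=b,\ x\ge\mathbf{0},\ x\in\mathbb{Z}^n\}$, assumed to have nonempty feasible region; its LP relaxation $\mathcal{LP}$ is $\min\{c^\intercal x\mid Ax=b,\ x\ge\mathbf{0},\ x\in\mathbb{R}^n\}$. Write $[k]=\{1,\dots,k\}$. A basis is a set $B\subseteq[n]$ with $|B|=m$ such that the submatrix $A_B$ of columns indexed by $B$ is nonsingular; $N=[n]\setminus B$, $A_N$ is the submatrix of columns indexed by $N$, and for $v\in\mathbb{R}^n$, $v_B,v_N$ are its subvectors indexed by $B,N$. The basis $B$ is feasible for $\mathcal{LP}$ if $A_B^{-1}b\ge\mathbf{0}$. $\mathcal{B}$ is the finite set of all feasible bases of $\mathcal{LP}$. For $d\in\mathbb{R}^n$, $\bar d_N:=(d_N^\intercal-d_B^\intercal A_B^{-1}A_N)^\intercal\in\mathbb{R}^{n-m}$ is the vector of reduced costs. The Gomory corner relaxation $\mathcal{G}^B$ is $\min\{c_B^\intercal x_B+c_N^\intercal x_N\mid A_Bx_B+A_Nx_N=b,\ x_N\ge\mathbf{0},\ x\in\mathbb{Z}^n\}$. $\mathcal{G}^{B,d}$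 is the same problem with $c$ replaced by $d$, and $\mathit{IFR}(\mathcal{G}^B,x^\circ)$ is the set of all $d\in\mathbb{R}^n$ such that $x^\circ$ is an optimal solution for $\mathcal{G}^{B,d}$. Shortest path problem. Fix a Smith normal form of $A_B$: unimodular $S,T\in\mathbb{Z}^{m\times m}$ and a positive vector $w\in\mathbb{Z}^m$ with $SA_BT=\mathrm{diag}(w)$. For $u,v\in\mathbb{Z}^m$, $u\equiv v\ (\mathrm{mod}\ w)$ means $u_i-v_i$ is an integer multiple of $w_i$ for every $i\in[m]$. Consider the directed (multi)graph with vertex set $V=\prod_{i\in[m]}\{0,\dots,w_i-1\}$, whose vertices represent the classes of $\mathbb{Z}^m$ modulo $w$ (elements of $\mathbb{Z}^m$ are identified with their representative in $V$), and arc set $E=\bigcup_{j\in[n-m]}E_j$ with $E_j=\{(u,u+(SA_N)_j)\mid u\in V\}$, where $(SA_N)_j$ is the $j$th column of $SA_N$ and arcs for different $j$ are regarded as distinct. $\mathcal{S}^B$ is the problem of finding a minimum-weight path (directed walk, vertices may repeat) from $\mathbf{0}$ to $Sb$, each arc of $E_j$ having weight $(\bar c_N)_j$; $\mathcal{S}^{B,d}$ is the same with weights $(\bar d_N)_j$. A solution is represented by a vector $p\in\mathbb{Z}_+^{n-m}$, meaning a walk from $\mathbf{0}$ that uses exactly $p_j$ arcs of $E_j$ for each $j$; it ends at $SA_Np$ modulo $w$, so it is feasible iff $SA_Np\equiv Sb\ (\mathrm{mod}\ w)$, and its weight in $\mathcal{S}^{B,d}$ is $\bar d_N^\intercal p$.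 For a feasible $x^\circ_N\in\mathbb{Z}_+^{n-m}$, $\mathit{IFR}(\mathcal{S}^B,x^\circ_N)$ is the set of all $d\in\mathbb{R}^n$ such that $\bar d_N^\intercal x^\circ_N$ equals the optimal value of $\mathcal{S}^{B,d}$, i.e. $x^\circ_N$ is an optimal solution for $\mathcal{S}^{B,d}$. *)

(* Defs.v *)
From HB Require Import structures.
From mathcomp Require Import all_boot all_order all_algebra.
From mathcomp Require Import classical_sets reals.

Set Implicit Arguments.
Unset Strict Implicit.
Unset Printing Implicit Defensive.

Import Order.TTheory GRing.Theory Num.Theory.

Local Open Scope classical_set_scope.
Local Open Scope ring_scope.

Definition nonneg (K : numDomainType) k (v : 'cV[K]_k) : Prop :=
  forall i, 0 <= v i 0.

Definition dot (K : pzRingType) k (u v : 'cV[K]_k) : K := (u^T *m v) 0 0.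

Definition toR (R : realType) p q (M : 'M[int]_(p, q)) : 'M[R]_(p, q) :=
  map_mx (intr : int -> R) M.
Arguments toR R {p q} M.

Record min_problem (R : realType) (T : Type) := MinProblem {
  feasible : set T;
  objective : T -> R
}.

Definition optimal_solution (R : realType) T (P : min_problem R T) (x : T) : Prop :=
  feasible P x /\ forall y, feasible P y -> objective P x <= objective P y.

Definition is_optimal_value (R : realType) T (P : min_problem R T) (z : R) : Prop :=
  (exists2 x, feasible P x & objective P x = z) /\
  forall y, feasible P y -> z <= objective P y.

Definition integer_program (R : realType) m n (A : 'M[int]_(m, n))
    (b : 'cV[int]_m) (c : 'cV[R]_n) : min_problem R 'cV[int]_n :=
  MinProblem [set x | A *m x = b /\ nonneg x] (fun x => dot c (toR R x)).

(* The elements of a set of column indices are enumerated in increasing order;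
   the cardinality proof makes the submatrix of basic columns square. *)
Definition basic_index m n (B : {set 'I_n}) (cardB : #|B| = m) (k : 'I_m) : 'I_n :=
  enum_val (cast_ord (esym cardB) k).

Record basis m n (A : 'M[int]_(m, n)) := Basis {
  basis_set : {set 'I_n};
  card_basis : #|basis_set| = m;
  basis_nonsingular : \det (colsub (basic_index card_basis) A) != 0
}.

Section Corner.
Variables (R : realType) (m n : nat) (A : 'M[int]_(m, n)) (b : 'cV[int]_m).
Variable B : basis A.

(* The number of nonbasic columns, equal to n - m. *)
Definition nN : nat := #|~: basis_set B|.

Definition nonbasic_index (j : 'I_nN) : 'I_n := enum_val j.

Definition mxB : 'M[int]_m := colsub (basic_index (card_basis B)) A.
Definition mxN : 'M[int]_(m, nN) := colsub nonbasic_index A.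

Definition vecB (K : Type) (v : 'cV[K]_n) : 'cV[K]_m :=
  rowsub (basic_index (card_basis B)) v.
Definition vecN (K : Type) (v : 'cV[K]_n) : 'cV[K]_nN :=
  rowsub nonbasic_index v.

Definition feasible_basis : Prop := nonneg (invmx (toR R mxB) *m toR R b).

Definition reduced_costs (d : 'cV[R]_n) : 'cV[R]_nN :=
  ((vecN d)^T - (vecB d)^T *m invmx (toR R mxB) *m toR R mxN)^T.

Definition corner_relaxation (d : 'cV[R]_n) : min_problem R 'cV[int]_n :=
  MinProblem
    [set x | mxB *m vecB x + mxN *m vecN x = b /\ nonneg (vecN x)]
    (fun x => dot (vecB d) (toR R (vecB x)) + dot (vecN d) (toR R (vecN x))).

Definition IFR_corner (x : 'cV[int]_n) : set 'cV[R]_n :=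
  [set d | optimal_solution (corner_relaxation d) x].

End Corner.
Arguments feasible_basis R {m n A} b B.

(* No divisibility chain between the entries of w is required. *)
Definition smith_normal_form m (M S T : 'M[int]_m) (w : 'rV[int]_m) : Prop :=
  [/\ S \in unitmx, T \in unitmx, forall i, 0 < w 0 i & S *m M *m T = diag_mx w].

Section ShortestPath.
Variables (R : realType) (m n : nat) (A : 'M[int]_(m, n)) (b : 'cV[int]_m).
Variables (B : basis A) (S : 'M[int]_m) (w : 'rV[int]_m).

Definition vertex : set 'cV[int]_m := [set u | forall i, 0 <= u i 0 < w 0 i].

(* The representative in [vertex] of the class of u modulo w. *)
Definition representative (u : 'cV[int]_m) : 'cV[int]_m :=
  \col_i modz (u i 0) (w 0 i).

(* The pair (u, j) is the arc of E_j leaving u: keeping the label j makes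
   parallel arcs with different labels distinct. *)
Definition arc_type : Type := ('cV[int]_m * 'I_(nN B))%type.

Definition arc : set arc_type := [set e | vertex e.1].

Definition arc_source (e : arc_type) : 'cV[int]_m := e.1.
Definition arc_target (e : arc_type) : 'cV[int]_m :=
  representative (e.1 + col e.2 (S *m mxN B)).

Fixpoint walk (u : 'cV[int]_m) (es : seq arc_type) (v : 'cV[int]_m) : Prop :=
  if es is e :: es' then [/\ arc e, arc_source e = u & walk (arc_target e) es' v]
  else u = v.

Definition walk_weight (d : 'cV[R]_n) (es : seq arc_type) : R :=
  \sum_(e <- es) reduced_costs B d e.2 0.

Definition shortest_path (d : 'cV[R]_n) : min_problem R (seq arc_type) :=
  MinProblem [set es | walk 0 es (representative (S *m b))] (walk_weight d).

Definition arc_counts (es : seq arc_type) : 'cV[int]_(nN B) :=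
  \col_j (count (fun e : arc_type => e.2 == j) es)%:Z.

(* The vector p stands for a walk from 0 to S b using p_j arcs of E_j. *)
Definition path_vector (p : 'cV[int]_(nN B)) : Prop :=
  exists2 es, walk 0 es (representative (S *m b)) & arc_counts es = p.

Definition IFR_shortest_path (p : 'cV[int]_(nN B)) : set 'cV[R]_n :=
  [set d | path_vector p /\
           is_optimal_value (shortest_path d) (dot (reduced_costs B d) (toR R p))].

End ShortestPath.

(* Main.v *)
Require Import Defs.
From HB Require Import structures.
From mathcomp Require Import all_boot all_order all_algebra.
From mathcomp Require Import classical_sets reals.

Set Implicit Arguments.
Unset Strict Implicit.
Unset Printing Implicit Defensive.

Import Order.TTheory GRing.Theory Num.Theory.

Local Open Scope classical_set_scope.
Local Open Scope ring_scope.

(** A walk from 0 never needs to be looked at arc by arc: its endpoint is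
    [S *m A_N *m p] modulo [w], where [p] counts the arcs of each label, and
    every nonnegative [p] is the count vector of some walk
    ([walk_end], [walk_of_labels],
    [nonneg_label_counts]).  Hence [p] is feasible for the shortest path
    problem iff [p >= 0] and [S *m A_N *m p] is congruent to [S *m b] modulo [w]
    ([path_vectorP]).

    Since [S *m A_B *m T] is the diagonal matrix of [w] and [S], [T] are
    unimodular, that congruence says exactly that [A_B *m y + A_N *m p = b] has
    an integral solution [y] ([representative_smithP]).  So [x |-> x_N] maps the
    feasible points of the corner relaxation onto the feasible vectors [p] of the
    shortest path problem ([path_vector_cornerP]).

    Finally, eliminating [x_B = A_B^-1 (b - A_N x_N)] from the objective of the
    corner relaxation turns it into the total reduced cost of [x_N], which is the
    weight of the walk, plus a constant that does not depend on [x]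
    ([corner_objectiveE], [walk_weightE]).  Optimality of [x0] and of [x0_N] is
    therefore the same condition. *)

Section Indices.
Variables (m n : nat) (A : 'M[int]_(m, n)) (B : basis A).

Lemma basic_index_inj : injective (basic_index (card_basis B)).
Proof. by move=> k l /enum_val_inj /cast_ord_inj. Qed.

Lemma basic_index_neq (k : 'I_m) (j : 'I_(nN B)) :
  basic_index (card_basis B) k != nonbasic_index j.
Proof.
have Bk : basic_index (card_basis B) k \in basis_set B by exact: enum_valP.
have : nonbasic_index j \in ~: basis_set B by exact: enum_valP.
by rewrite inE; apply: contraNneq => <-.
Qed.

Lemma vecBN_surj (K : nmodType) (y : 'cV[K]_m) (p : 'cV[K]_(nN B)) :
  exists x : 'cV[K]_n, vecB B x = y /\ vecN B x = p.
Proof.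
(* At each index exactly one of the two sums is nonempty, with a single term. *)
exists (\col_i (\sum_(k | basic_index (card_basis B) k == i) y k 0
                + \sum_(j | @nonbasic_index _ _ _ B j == i) p j 0)).
split; apply/colP => k; rewrite !mxE.
  rewrite (big_pred1 k) => [|l]; last exact: (inj_eq basic_index_inj).
  by rewrite big_pred0 ?addr0 // => j; rewrite eq_sym; apply/negbTE/basic_index_neq.
rewrite big_pred0 => [|l]; last by apply/negbTE/basic_index_neq.
rewrite (big_pred1 k) ?add0r // => l.
exact: (inj_eq enum_val_inj).
Qed.

End Indices.

Section Representative.
Variables (m : nat) (w : 'rV[int]_m).
Hypothesis w_gt0 : forall i, 0 < w 0 i.

Lemma representative_vertex u : vertex w (representative w u).
Proof. by move=> i; rewrite mxE modz_ge0 ?ltz_pmod ?gt_eqF. Qed.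

Lemma representative_id u : vertex w u -> representative w u = u.
Proof. by move=> wu; apply/colP => i; rewrite mxE modz_small. Qed.

Lemma vertex0 : vertex w 0.
Proof. by move=> i; rewrite mxE lexx /=. Qed.

Lemma representativeDl u v :
  representative w (representative w u + v) = representative w (u + v).
Proof. by apply/colP => i; rewrite !mxE modzDml. Qed.

Lemma representative_eqP u v :
  representative w u = representative w v <->
  exists z, v - u = diag_mx w *m z.
Proof.
split=> [uv | [z vu]].
  exists (\col_i divz (v i 0 - u i 0) (w 0 i)).
  apply/colP => i; rewrite mul_diag_mx !mxE mulrC divzK //.
  by rewrite -eqz_mod_dvd; move/colP/(_ i): uv; rewrite !mxE => ->.
apply/colP => i; rewrite !mxE; apply/esym/eqP; rewrite eqz_mod_dvd.
by move/colP/(_ i): vu; rewrite mul_diag_mx !mxE => ->; rewrite dvdz_mulr.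
Qed.

(** Congruence modulo [w], read through the Smith normal form of [M], is
    congruence modulo the lattice spanned by the columns of [M]. *)
Lemma representative_smithP (M S T : 'M[int]_m) (u v : 'cV[int]_m) :
  smith_normal_form M S T w ->
  representative w (S *m u) = representative w (S *m v) <->
  exists y, M *m y + u = v.
Proof.
case=> uS uT _ SMT; rewrite representative_eqP.
split=> [[z Ez] | [y <-]].
  exists (T *m z); apply: (can_inj (mulKmx uS)).
  by rewrite mulmxDr !mulmxA SMT -Ez subrK.
exists (invmx T *m y).
by rewrite -SMT mulmxDr addrK -!mulmxA mulKVmx.
Qed.

End Representative.

Section Walks.
Variables (m n : nat) (A : 'M[int]_(m, n)) (B : basis A).
Variables (S : 'M[int]_m) (w : 'rV[int]_m).
Hypothesis w_gt0 : forall i, 0 < w 0 i.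

Let SN := S *m mxN B.

Lemma arc_counts_nil : arc_counts ([::] : seq (arc_type B)) = 0.
Proof. by apply/colP => j; rewrite !mxE. Qed.

Lemma arc_counts_cons (e : arc_type B) es :
  arc_counts (e :: es) = delta_mx e.2 0 + arc_counts es.
Proof. by apply/colP => j; rewrite !mxE /= PoszD andbT eq_sym; case: eqP. Qed.

Lemma arc_counts_nonneg (es : seq (arc_type B)) : nonneg (arc_counts es).
Proof. by move=> j; rewrite mxE. Qed.

Lemma arc_target_step u (e : arc_type B) (p : 'cV[int]_(nN B)) : e.1 = u ->
  representative w (arc_target S w e + SN *m p)
  = representative w (u + SN *m (delta_mx e.2 0 + p)).
Proof. by move=> <-; rewrite representativeDl mulmxDr -colE addrA. Qed.

Lemma walk_end u (es : seq (arc_type B)) v : vertex w u -> walk S w u es v ->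
  v = representative w (u + SN *m arc_counts es).
Proof.
elim: es u => [|e es IH] u wu /=.
  by rewrite arc_counts_nil mulmx0 addr0 representative_id.
case=> _ eu /IH ->; last exact: representative_vertex.
by rewrite arc_counts_cons (arc_target_step _ eu).
Qed.

(** From any vertex, the arc labels of a walk can be prescribed freely. *)
Lemma walk_of_labels u (js : seq 'I_(nN B)) : vertex w u ->
  exists2 es : seq (arc_type B), map snd es = js &
    walk S w u es (representative w (u + SN *m arc_counts es)).
Proof.
elim: js u => [|j js IH] u wu.
  by exists [::] => //=; rewrite arc_counts_nil mulmx0 addr0 representative_id.
pose e : arc_type B := (u, j).
have [|es <- es_walk] := IH (arc_target S w e); first exact: representative_vertex.
exists (e :: es) => //=; split=> //.
by rewrite arc_counts_cons -(@arc_target_step u e).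
Qed.

(** Every nonnegative vector is the label count of some sequence: repeat each
    label [j] exactly [p j] times. *)
Lemma nonneg_label_counts k (p : 'cV[int]_k) : nonneg p ->
  exists js : seq 'I_k, forall j, (count_mem j js)%:Z = p j 0.
Proof.
move=> p_ge0; exists (flatten [seq nseq (absz (p j 0)) j | j <- enum 'I_k]) => j.
rewrite count_flatten -map_comp sumnE big_map big_enum /= (bigD1 j) //=.
rewrite count_nseq /= eqxx mul1n big1 ?addn0 ?gez0_abs // => i ij.
by rewrite count_nseq /= (negbTE ij) mul0n.
Qed.

Lemma path_vectorP b p : path_vector b S w p <->
  nonneg p /\ representative w (SN *m p) = representative w (S *m b).
Proof.
have w0 := vertex0 w_gt0; split=> [[es es_walk <-] | [p_ge0 Ep]].
  split; first exact: arc_counts_nonneg.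
  by rewrite (walk_end w0 es_walk) add0r.
have [js js_counts] := nonneg_label_counts p_ge0.
have [es es_js es_walk] := walk_of_labels js w0.
have es_p : arc_counts es = p.
  by apply/colP => j; rewrite mxE -js_counts -es_js count_map.
by exists es => //; rewrite -Ep -es_p -[SN *m _]add0r.
Qed.

Lemma walk_weightE (R : realType) (d : 'cV[R]_n) (es : seq (arc_type B)) :
  walk_weight d es = dot (reduced_costs B d) (toR R (arc_counts es)).
Proof.
rewrite /walk_weight /dot; elim: es => [|e es IH].
  by rewrite big_nil arc_counts_nil /toR map_mx0 mulmx0 mxE.
rewrite big_cons IH arc_counts_cons /toR map_mxD mulmxDr [RHS]mxE map_delta_mx.
by rewrite -colE; congr (_ + _); rewrite [RHS]mxE [RHS]mxE.
Qed.

End Walks.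

Section Corner.
Variables (R : realType) (m n : nat) (A : 'M[int]_(m, n)) (b : 'cV[int]_m).
Variable B : basis A.

Lemma toR_mxB_unit : toR R (mxB B) \in unitmx.
Proof. by rewrite unitmxE unitfE /toR det_map_mx intr_eq0 basis_nonsingular. Qed.

(** The first term of the right-hand side does not depend on [x]. *)
Lemma corner_objectiveE (d : 'cV[R]_n) (x : 'cV[int]_n) :
  feasible (corner_relaxation b B d) x ->
  objective (corner_relaxation b B d) x
  = dot (vecB B d) (invmx (toR R (mxB B)) *m toR R b)
    + dot (reduced_costs B d) (toR R (vecN B x)).
Proof.
case=> xb _ /=; rewrite /dot /reduced_costs trmxK.
have addE (X Y : 'M[R]_1) : X 0 0 + Y 0 0 = (X + Y) 0 0 by rewrite [RHS]mxE.
rewrite !addE -xb /toR map_mxD !map_mxM; congr fun_of_matrix.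
rewrite [invmx _ *m _]mulmxDr mulKmx ?toR_mxB_unit // mulmxDr mulmxBl !mulmxA.
by rewrite addrA addrAC addrK.
Qed.

(** The projection [x |-> x_N] maps the feasible set of the corner relaxation
    onto the feasible vectors of the shortest path problem. *)
Lemma path_vector_cornerP (S T : 'M[int]_m) (w : 'rV[int]_m) (d : 'cV[R]_n)
    (p : 'cV[int]_(nN B)) : smith_normal_form (mxB B) S T w ->
  path_vector b S w p <->
  exists2 x, feasible (corner_relaxation b B d) x & vecN B x = p.
Proof.
move=> snf; have [_ _ w_gt0 _] := snf.
rewrite path_vectorP // -mulmxA (representative_smithP _ _ snf).
split=> [[p_ge0 [y yb]] | [x [xb x_ge0] <-]].
  by have [x [xy xp]] := vecBN_surj y p; exists x; rewrite //= xy xp.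
by split=> //; exists (vecB B x).
Qed.

End Corner.

Theorem theorem4 (R : realType) (m n : nat) (hmn : (m <= n)%N)
    (A : 'M[int]_(m, n)) (hA : row_free (toR R A))
    (b : 'cV[int]_m) (c : 'cV[R]_n)
    (hIP : feasible (integer_program A b c) !=set0)
    (B : basis A) (hB : feasible_basis R b B)
    (S T : 'M[int]_m) (w : 'rV[int]_m)
    (hSTw : smith_normal_form (mxB B) S T w)
    (x0 : 'cV[int]_n) (hx0 : feasible (corner_relaxation b B c) x0) :
  IFR_shortest_path b S w (vecN B x0) = IFR_corner b B x0 :> set 'cV[R]_n.
Proof.
apply/seteqP; split=> d /=.
- case=> _ [_ x0_min]; split=> [|x hx]; first exact: hx0.
  rewrite !corner_objectiveE // lerD2l.
  have [es es_walk <-] : path_vector b S w (vecN B x).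
    by apply/(path_vector_cornerP b d _ hSTw); exists x.
  by rewrite -walk_weightE; apply: x0_min.
- case=> _ x0_min.
  have x0_path : path_vector b S w (vecN B x0).
    by apply/(path_vector_cornerP b d _ hSTw); exists x0.
  split=> //; split.
    have [es es_walk es_x0] := x0_path.
    by exists es; rewrite //= walk_weightE es_x0.
  move=> es es_walk /=; rewrite walk_weightE.
  have [|x hx <-] := (path_vector_cornerP b d (arc_counts es) hSTw).1.
    by exists es.
  by have := x0_min x hx; rewrite !corner_objectiveE // lerD2l.
Qed.
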